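(* Let $\Theta\subseteq\mathbb{R}^d$ index a model $\{P_\theta:\theta\in\Theta\}$ and let $\Theta_\epsilon\subseteq\Theta$ be an $\epsilon$-discretization of $\Theta$, $\epsilon>0$. Assume $X^n=(X_1,\dots,X_n)$ has iid components with distribution $P$, and let $\hat\theta$ be the penalized MLE over $\Theta_\epsilon$ (iid modeling) with penalty $\mathcal{L}$. Assume that for some $\theta^*,\tilde\theta^*\in\Theta$, some radius $R$ and some $a,b,c>0$, the Hellinger affinity satisfies $A(P,P_\theta)\le a/\|\theta-\theta^*\|^b$ for $\theta$ outside the ball $B(\theta^*,R)$ and $A(P,P_\theta)\le e^{-c\|\theta-\tilde\theta^*\|^2}$ for $\theta$ inside the ball $B(\theta^*,R)$. If $R\ge \max(11a^{1/b},3\epsilon)$ and $n\ge 2(d+1)/b$, then $$\mathbb{E}\,D_B(P,P_{\hat\theta})\le 2\left[\mathcal{R}^{(n)}_{\Theta_\epsilon,\mathcal{L}}(P)+\frac{d\left[2\log\left(1+\frac{2\sqrt{2\pi}}{\epsilon\sqrt{nc}}\right)+2\log\left(1+\frac{4\sqrt2\,R}{\epsilon\sqrt{nb}}\right)\right]+3-\mathbb{E}\,\mathcal{L}(\hat\theta)}{n}\right].$$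
   Context: Lower-case letters denote densities: $p$ and $p_\theta$ are the densities of $P$ and $P_\theta$ with respect to a common dominating measure (Lebesgue or counting measure). The Hellinger affinity is $A(P,Q)=\int\sqrt{p(x)q(x)}\,dx$, the Bhattacharyya divergence is $D_B(P,Q)=2\log\frac{1}{A(P,Q)}$, and $D(P\|Q)$ is relative entropy; all are for a single observation. An $\epsilon$-discretization of $\Theta\subseteq\mathbb{R}^d$ is a set of the form $\Theta\cap(v+\epsilon\mathbb{Z}^d)$ for some $v\in\mathbb{R}^d$. The penalty is a function $\mathcal{L}$ with real values on $\Theta_\epsilon$. The penalized MLE $\hat\theta=\hat\theta(X^n)$ is a parameter maximizing $\sum_{i=1}^n\log p_\theta(X_i)-\mathcal{L}(\theta)$ over $\theta\in\Theta_\epsilon$; a maximizer is assumed to exist for every possible data value (ties broken arbitrarily). $\mathcal{R}^{(n)}_{\Theta_\epsilon,\mathcal{L}}(P)=\inf_{\theta\in\Theta_\epsilon}\{D(P\|P_\theta)+\mathcal{L}(\theta)/n\}$. $B(\theta^*,R)$ is the closed Euclidean ball. Expectations are over $X^n\sim P^n$. *)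

(* Defs.v *)
From mathcomp Require Import all_boot all_order all_algebra.
From mathcomp Require Import all_classical all_reals all_analysis.

Set Implicit Arguments.
Unset Strict Implicit.
Unset Printing Implicit Defensive.

Import Order.TTheory GRing.Theory Num.Theory.
Import numFieldNormedType.Exports.

Local Open Scope classical_set_scope.
Local Open Scope ring_scope.

(* The canonical norm of the library on row vectors is the sup norm. *)
Definition enorm (R : realType) (d : nat) (v : 'rV[R]_d) : R :=
  Num.sqrt (\sum_(j < d) v 0 j ^+ 2).

Definition eball (R : realType) (d : nat) (t : 'rV[R]_d) (r : R) :
    set 'rV[R]_d :=
  [set u | enorm (u - t) <= r].

Definition lattice (R : realType) (d : nat) (v : 'rV[R]_d) (eps : R) :
    set 'rV[R]_d :=
  [set u | exists z : 'rV[int]_d, u = v + eps *: map_mx intr z].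

Definition is_discretization (R : realType) (d : nat) (eps : R)
    (Theta Theta_eps : set 'rV[R]_d) : Prop :=
  exists v : 'rV[R]_d, Theta_eps = Theta `&` lattice v eps.

Section densities.
Context (dT : measure_display) (T : measurableType dT) (R : realType).
Variable mu : {measure set T -> \bar R}.
Local Open Scope ereal_scope.

Definition is_density (P : probability T R) (p : T -> R) : Prop :=
  [/\ measurable_fun [set: T] p,
      (forall x, (0 <= p x)%R) &
      (forall A, measurable A -> P A = \int[mu]_(x in A) (p x)%:E)].

Definition affinity (p q : T -> R) : \bar R :=
  \int[mu]_x (Num.sqrt (p x * q x))%:E.

(* Takes the value +oo when the affinity is 0, since 0^-1 = +oo and
   lne +oo = +oo. *)
Definition bhattacharyya (p q : T -> R) : \bar R :=
  2%:E * lne (affinity p q)^-1.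

(* Where p x = 0 the integrand is 0, because 0 * y = 0 for every extended real
   y; where p x > 0 = q x it is +oo. *)
Definition rel_entropy (p q : T -> R) : \bar R :=
  \int[mu]_x ((p x)%:E * lne ((p x)%:E / (q x)%:E)).

End densities.

(* The sets B i are allowed to be the whole space, so the product rule for the
   full family contains the product rule for all its subfamilies. *)
Definition iid (dO : measure_display) (Omega : measurableType dO)
    (dT : measure_display) (T : measurableType dT) (R : realType)
    (Pr : probability Omega R) (P : probability T R) (n : nat)
    (X : 'I_n -> {RV Pr >-> T}) : Prop :=
  (forall (i : 'I_n) (B : set T), measurable B ->
     distribution Pr (X i) B = P B) /\
  (forall B : 'I_n -> set T, (forall i, measurable (B i)) ->
     Pr (\bigcap_(i in [set: 'I_n]) (X i @^-1` B i)) =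
     (\prod_(i < n) Pr (X i @^-1` B i))%E).

Definition sample (dO : measure_display) (Omega : measurableType dO)
    (dT : measure_display) (T : measurableType dT) (R : realType)
    (Pr : probability Omega R) (n : nat)
    (X : 'I_n -> {RV Pr >-> T}) (w : Omega) : n.-tuple T :=
  [tuple X i w | i < n].

Section estimation.
Context (dT : measure_display) (T : measurableType dT) (R : realType) (d : nat).
Local Open Scope ereal_scope.

(* lne 0 = -oo, so that data of zero likelihood get the value -oo. *)
Definition penalized_loglik (pt : 'rV[R]_d -> T -> R) (L : 'rV[R]_d -> R)
    (n : nat) (x : n.-tuple T) (theta : 'rV[R]_d) : \bar R :=
  \sum_(i < n) lne (pt theta (tnth x i))%:E - (L theta)%:E.

(* An estimator takes countably many values, so the last clause states that it
   is a random variable; without it the expectations of functions of the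
   estimator need not make sense, as ties are broken arbitrarily. *)
Definition is_penalized_mle (Theta_eps : set 'rV[R]_d)
    (pt : 'rV[R]_d -> T -> R) (L : 'rV[R]_d -> R) (n : nat)
    (that : n.-tuple T -> 'rV[R]_d) : Prop :=
  [/\ (forall x, Theta_eps (that x)),
      (forall x theta, Theta_eps theta ->
         penalized_loglik pt L x theta <= penalized_loglik pt L x (that x)) &
      (forall theta, measurable (that @^-1` [set theta]))].

Definition resolvability (mu : {measure set T -> \bar R}) (p : T -> R)
    (Theta_eps : set 'rV[R]_d) (pt : 'rV[R]_d -> T -> R) (L : 'rV[R]_d -> R)
    (n : nat) : \bar R :=
  ereal_inf [set rel_entropy mu p (pt theta) + (L theta / n%:R)%:E
            | theta in Theta_eps].

End estimation.

(* Main.v *)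
Require Import Defs.
From mathcomp Require Import all_boot all_order all_algebra.
From mathcomp Require Import all_classical all_reals all_analysis.
From mathcomp Require Import measurable_realfun.
From mathcomp Require Import ring lra zify.

(** Write alpha(t) for the affinity of P and P_t, and D_B = - 2 log alpha for the
    corresponding divergence. For fixed t the variables sqrt (p_t / p) (X_i) are
    independent with mean alpha(t), so the tilted likelihood ratio
      Y_t = prod_i sqrt (p_t / p) (X_i) / alpha(t)^(n/2)
    has expectation alpha(t)^(n/2) ([tilted_lr_integral]). Whatever parameter
    the data select, its Y is one term of the sum of all of them, so
    E Y_that <= C as soon as the sum of alpha(t)^(n/2) over the discretization is
    at most C ([countable_selection_integral_le]).

    Since 2 log Y_t = (n/2) D_B(P, P_t) - log-likelihood ratio of P to P_t, and
    since the estimator maximizes the penalized likelihood, one has almost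
    surely, for every competitor t,
      (n/2) D_B(P, P_that) + L(that)
        <= 2 log Y_that + sum_i log (p / p_t) (X_i) + L(t)
    ([pointwise_bound]). Bounding log (Y / C) by Y / C - 1 and taking
    expectations, the right-hand side becomes 2 log C + n D(P || P_t) + L(t); the
    infimum over t is the resolvability ([mle_risk_resolvability]). The exponent
    n/2, instead of n, leaves half of D_B on the left, whence the factor 2 of
    the bound.

    What remains is the numerical bound C = e^(3/2) G^d H^d on the sum of
    alpha^(n/2) ([affinity_sum_le]), where G and H are the arguments of the two
    logarithms. Everything is reduced to one sum: the values of the Cauchy density
    1 / (1 + x^2) on a progression of step h add up to at most 1 + pi / h
    ([cauchy_sum_le]). As exp (- x^2) <= 1 / (1 + x^2), Gaussian sums over the
    d-dimensional lattice are bounded by products of such sums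
    ([gauss_sum_le]), which gives G^d for the parameters inside the ball.
    Outside, the power decay is cut into dyadic shells, on each of which it is
    dominated by a Gaussian of the width of the shell ([tail_sum_le]); the
    constant 11 makes the sum of all shells at most H^d. *)

Set Implicit Arguments.
Unset Strict Implicit.
Unset Printing Implicit Defensive.

Import Order.TTheory GRing.Theory Num.Theory.
Import numFieldNormedType.Exports.

Local Open Scope classical_set_scope.
Local Open Scope ring_scope.

(** * Sums over arithmetic progressions and lattices *)

Lemma ler_sum_subseq (R : numDomainType) (I : eqType) (s t : seq I)
    (F : I -> R) :
  uniq s -> {subset s <= t} -> (forall i, 0 <= F i) ->
  \sum_(i <- s) F i <= \sum_(i <- t) F i.
Proof.
elim: s t => [|i s IHs] t /=; first by move=> _ _ F0; rewrite big_nil sumr_ge0.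
move=> /andP[is_ us] st F0.
have it : i \in t by apply: st; rewrite inE eqxx.
rewrite big_cons (big_rem i it) /= lerD2l; apply: IHs => // j js.
have jt : j \in t by apply: st; rewrite inE js orbT.
have := perm_mem (perm_to_rem it) j; rewrite jt inE => /esym/orP[/eqP ji|//].
by move: is_; rewrite -ji js.
Qed.

Section one_dimension.
Context {R : realType}.
Implicit Types (h w x y m : R).

Let cauchy (x : R) : R := (1 + x ^+ 2)^-1.

Let cauchy_ge0 x : 0 <= cauchy x.
Proof. by rewrite invr_ge0 addr_ge0 ?sqr_ge0. Qed.

Let cauchy_le1 x : cauchy x <= 1.
Proof. by rewrite invf_le1 ?lerDl ?sqr_ge0// ltr_pwDl// sqr_ge0. Qed.

Let le_cauchy x y : x ^+ 2 <= y ^+ 2 -> cauchy y <= cauchy x.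
Proof.
by move=> xy; rewrite lef_pV2 ?lerD2l// posrE ltr_pwDl// sqr_ge0.
Qed.

Lemma atan_increment_ge x y m : x <= y ->
  (forall t, x <= t <= y -> m <= (1 + t ^+ 2)^-1) ->
  m * (y - x) <= atan y - atan x.
Proof.
move=> xy mt.
have datan t : t \in `]x, y[ -> is_derive t 1 (@atan R) (cauchy t).
  by move=> _; exact: is_derive1_atan.
have catan : {within `[x, y], continuous (@atan R)}.
  by apply: continuous_subspaceT => t; exact: continuous_atan.
have [t txy ->] := MVT_segment xy datan catan.
by rewrite ler_wpM2r ?subr_ge0// mt.
Qed.

(** Each summand except the larger of the two next to the mode is charged to the
    increment of atan over an adjacent segment of length h, and the exceptional
    one is at most 1. *)
Lemma cauchy_sum_interval h w N : 0 < h -> 0 <= w < h ->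
  \sum_(k < N.+1) (1 + (w + h * k%:R) ^+ 2)^-1 +
  \sum_(k < N.+1) (1 + (w - h * k.+1%:R) ^+ 2)^-1 <=
  1 + (atan (w + h * N%:R) - atan (w - h * N.+1%:R)) / h.
Proof.
move=> h0 /andP[w0 wh]; elim: N => [|N IHN].
  rewrite !big_ord_recr !big_ord0 /= !add0r mulr0 addr0 mulr1.
  rewrite -/(cauchy _) -/(cauchy (w - h)).
  (* The segment from w - h to w contains the mode 0, and the density there is
     at least its smaller endpoint value, while the larger one is at most 1. *)
  suff min_le m : m <= cauchy w -> m <= cauchy (w - h) ->
      m <= (atan w - atan (w - h)) / h.
    have [le|/ltW le] := leP (cauchy w) (cauchy (w - h)).
      by rewrite addrC lerD// min_le.
    by rewrite lerD// min_le.
  move=> mw mwh; rewrite ler_pdivlMr//.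
  have := @atan_increment_ge (w - h) w m; rewrite opprB addrCA subrr addr0; apply.
    by rewrite gerBl ltW.
  move=> t /andP[t1 t2]; have [t0|t0] := leP 0 t.
    by apply: (le_trans mw); apply: le_cauchy; nra.
  by apply: (le_trans mwh); apply: le_cauchy; nra.
rewrite big_ord_recr [X in _ + X]big_ord_recr /= addrACA.
apply: (le_trans (lerD IHN (lexx _))).
rewrite -addrA lerD2l -lerBrDl -mulrBl ler_pdivlMr// mulrDl.
set a1 := atan (w + h * N.+1%:R); set b1 := atan (w - h * N.+2%:R).
set a0 := atan (w + h * N%:R); set b0 := atan (w - h * N.+1%:R).
rewrite (_ : a1 - b1 - (a0 - b0) = (a1 - a0) + (b0 - b1)); last by ring.
rewrite {}/a1 {}/b1 {}/a0 {}/b0.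
have hN : 0 <= h * N%:R by rewrite mulr_ge0// ltW.
have hS k : h * k.+1%:R = h * k%:R + h by rewrite -natr1; ring.
apply: lerD.
- rewrite [X in _ * X](_ : _ = (w + h * N.+1%:R) - (w + h * N%:R)); last first.
    by rewrite hS; ring.
  apply: atan_increment_ge; first by rewrite hS; lra.
  move=> t; rewrite hS => /andP[t1 t2]; apply: le_cauchy.
  by rewrite ler_sqr ?nnegrE; lra.
- rewrite [X in _ * X](_ : _ = (w - h * N.+1%:R) - (w - h * N.+2%:R)); last first.
    by rewrite (hS N.+1); ring.
  apply: atan_increment_ge; first by rewrite !hS; lra.
  move=> t; rewrite !hS => /andP[t1 t2]; apply: le_cauchy.
  by rewrite -sqrrN -[leRHS]sqrrN ler_sqr ?nnegrE; lra.
Qed.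

(** The atan increments telescope to at most pi. The shift z0 brings the first
    nonnegative point of the progression into [0, h). *)
Lemma cauchy_sum_le h w (s : seq int) : 0 < h -> uniq s ->
  \sum_(z <- s) (1 + (h * z%:~R + w) ^+ 2)^-1 <= 1 + pi / h.
Proof.
move=> h0 us.
pose z0 : int := Num.ceil (- w / h).
pose w0 := h * z0%:~R + w.
have w0h : 0 <= w0 < h.
  have := ceil_ge (- w / h); have := ceilB1_lt (- w / h).
  rewrite -/z0 rmorphB /= ltr_pdivlMr// ler_pdivrMr// /w0 => A B.
  by apply/andP; split; nra.
pose N := (\sum_(z <- s) `|z - z0|)%N.
have sN z : z \in s -> (`|z - z0| <= N)%N.
  by move=> zs; rewrite /N (big_rem z zs) leq_addr.
pose t := [seq z0 + Posz k | k <- iota 0 N.+1] ++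
          [seq z0 - Posz k.+1 | k <- iota 0 N.+1].
have st : {subset s <= t}.
  move=> z /sN zN; rewrite mem_cat; have [zz|zz] := leP z0 z.
    apply/orP; left; apply/mapP; exists `|z - z0|%N; last lia.
    by rewrite mem_iota; lia.
  apply/orP; right; apply/mapP; exists `|z - z0|.-1%N; last lia.
  by rewrite mem_iota; lia.
apply: (le_trans (@ler_sum_subseq _ _ s t _ us st _)).
  by move=> z; exact: cauchy_ge0.
rewrite big_cat !big_map /=.
have -> : \sum_(j <- iota 0 N.+1) (1 + (h * (z0 + Posz j)%:~R + w) ^+ 2)^-1 =
   \sum_(k < N.+1) (1 + (w0 + h * k%:R) ^+ 2)^-1.
  rewrite -(big_mkord xpredT (fun k => (1 + (w0 + h * k%:R) ^+ 2)^-1)) /index_iota subn0.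
  by apply: eq_bigr => k _; rewrite /w0 rmorphD /=; congr (1 + _ ^+ 2)^-1; rewrite pmulrn; ring.
have -> : \sum_(j <- iota 0 N.+1) (1 + (h * (z0 - Posz j.+1)%:~R + w) ^+ 2)^-1 =
   \sum_(k < N.+1) (1 + (w0 - h * k.+1%:R) ^+ 2)^-1.
  rewrite -(big_mkord xpredT (fun k => (1 + (w0 - h * k.+1%:R) ^+ 2)^-1)) /index_iota subn0.
  by apply: eq_bigr => k _; rewrite /w0 rmorphB /=; congr (1 + _ ^+ 2)^-1; rewrite -pmulrn; ring.
apply: (le_trans (cauchy_sum_interval N h0 w0h)).
rewrite lerD2l ler_wpM2r ?invr_ge0 ?ltW//.
have := atan_ltpi2 (w0 + h * N%:R); have := atan_gtNpi2 (w0 - h * N.+1%:R).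
by lra.
Qed.

End one_dimension.

Section lattice_sums.
Context {R : realType} {d : nat}.
Implicit Types (v t : 'rV[R]_d) (z : 'rV[int]_d) (eps r m s : R).

Definition lattice_point v eps z : 'rV[R]_d := v + eps *: map_mx intr z.

(** A finite set of lattice points lies in a box, over which the sum of products
    factors into a product of sums. *)
Lemma prod_sum_le (F : 'I_d -> int -> R) (B : R) (S : seq 'rV[int]_d) :
  (forall j i, 0 <= F j i) ->
  (forall j (S1 : seq int), uniq S1 -> \sum_(i <- S1) F j i <= B) ->
  uniq S -> \sum_(z <- S) \prod_(j < d) F j (z 0 j) <= B ^+ d.
Proof.
move=> F0 FB uS.
pose N := (\sum_(z <- S) \sum_(j < d) `|z 0%R j|)%N.
have SN z j : z \in S -> (`|z 0%R j| <= N)%N.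
  move=> zS; rewrite /N (big_rem z zS) /= (bigD1 j) //= -addnA.
  by rewrite leq_addr.
pose shift (i : 'I_(N + N).+1) : int := Posz i - Posz N.
pose back (f : {ffun 'I_d -> 'I_(N + N).+1}) : 'rV[int]_d :=
  \row_j shift (f j).
have shift_inj : injective shift.
  by move=> i j; rewrite /shift => ij; apply: val_inj => /=; lia.
pose box := [seq back f | f <- index_enum {ffun 'I_d -> 'I_(N + N).+1}].
apply: (le_trans (@ler_sum_subseq _ _ S box _ uS _ _)).
- move=> z zS; apply/mapP.
  exists [ffun j => inord `|(z 0 j + Posz N)%R|%N]; first by rewrite mem_index_enum.
  apply/rowP => j; rewrite mxE ffunE /shift.
  move: (SN z j zS); move: (z 0 j) => y yN.
  by rewrite inordK; move: y yN => y yN; lia.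
- by move=> z; apply: prodr_ge0.
rewrite big_map.
under eq_bigr => f _ do under eq_bigr => j _ do rewrite mxE.
rewrite -(bigA_distr_bigA (fun j i => F j (shift i))) /=.
rewrite -[X in _ <= _ ^+ X]card_ord -prodr_const.
apply: ler_prod => j _; apply/andP; split; first by apply: sumr_ge0.
rewrite -(big_map shift xpredT (F j)); apply: FB.
by rewrite map_inj_uniq ?index_enum_uniq.
Qed.

Lemma enorm_sqr v : enorm v ^+ 2 = \sum_(j < d) v 0 j ^+ 2.
Proof. by rewrite sqr_sqrtr// sumr_ge0// => j _; rewrite sqr_ge0. Qed.

Lemma expRN_le_cauchy (x : R) : expR (- x ^+ 2) <= (1 + x ^+ 2)^-1.
Proof.
by rewrite expRN lef_pV2 ?posrE ?expR_gt0 ?expR_ge1Dx// ltr_pwDl// sqr_ge0.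
Qed.

Lemma gauss_sum_le v t eps s (S : seq 'rV[int]_d) : 0 < eps -> 0 < s ->
  uniq S ->
  \sum_(z <- S) expR (- (s * enorm (lattice_point v eps z - t) ^+ 2)) <=
  (1 + pi / (eps * Num.sqrt s)) ^+ d.
Proof.
move=> eps0 s0 uS.
have q0 : 0 < Num.sqrt s by rewrite sqrtr_gt0.
pose F j (i : int) : R :=
  (1 + ((eps * Num.sqrt s) * i%:~R + Num.sqrt s * (v 0 j - t 0 j)) ^+ 2)^-1.
apply: le_trans (@prod_sum_le F _ S _ _ uS).
- apply: ler_sum => z _; rewrite enorm_sqr mulr_sumr -sumrN expR_sum.
  apply: ler_prod => j _; rewrite expR_ge0 /=.
  rewrite !mxE /F.
  rewrite [X in (1 + X ^+ 2)^-1](_ : _ =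
    Num.sqrt s * (v 0 j + eps * (z 0 j)%:~R - t 0 j)); last by ring.
  by rewrite -[in s * _](sqr_sqrtr (ltW s0)) -exprMn; exact: expRN_le_cauchy.
- by move=> j i; rewrite invr_ge0 addr_ge0// sqr_ge0.
- by move=> j S1 uS1; apply: cauchy_sum_le => //; rewrite mulr_gt0.
Qed.

Lemma expR1_le4 : expR 1 <= 4 :> R.
Proof.
have h : expR (- (1 / 2)) >= 2^-1 :> R.
  by apply: le_trans (expR_ge1Dx _); lra.
move: h; rewrite expRN lef_pV2 ?posrE ?expR_gt0// => h.
rewrite (_ : 1 = 1 / 2 + 1 / 2 :> R); last by lra.
by rewrite expRD; have := expR_gt0 (1 / 2 : R); nra.
Qed.

Lemma sum_half_pow_le2 (K : nat) : \sum_(k < K) 2^-1 ^+ k <= 2 :> R.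
Proof.
suff -> : \sum_(k < K) 2^-1 ^+ k = 2 - 2 * 2^-1 ^+ K :> R.
  by rewrite gerBl mulr_ge0// exprn_ge0.
elim: K => [|K IHK]; first by rewrite big_ord0 expr0; lra.
by rewrite big_ord_recr /= IHK exprS; lra.
Qed.

Lemma dyadic_shell (x : R) : 1 < x ->
  exists k : nat, 2 ^+ k < x <= 2 ^+ k.+1.
Proof.
move=> x1.
have ex : exists k, x <= 2 ^+ k.+1.
  exists (Num.trunc x).+1; apply/ltW/(lt_trans (truncnS_gt x)).
  by rewrite -natrX ltr_nat (ltn_trans (ltn_expl _ (isT : 1 < 2)%N))// ltn_exp2l.
case: (ex_minnP ex) => -[|k] xk kmin.
  by exists 0%N; rewrite expr0 x1.
exists k.+1; rewrite xk andbT ltNge; apply/negP => /kmin.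
by rewrite ltnn.
Qed.

(** The base is below 1, so the exponent m may be lowered to d + 1; the factor
    (2^k)^d of the number of points in the shell then leaves one power 2^-k. *)
Lemma shell_weight_le m (k : nat) : d%:R + 1 <= m ->
  (expR 1 / (11 * 2 ^+ k)) `^ m * (2 ^+ k.+1) ^+ d <= 2^-1 * 2^-1 ^+ k :> R.
Proof.
move=> dm.
have p0 : 0 < 2 ^+ k :> R by rewrite exprn_gt0.
have p1 : 1 <= 2 ^+ k :> R by rewrite exprn_ege1// ler1n.
have e4 := expR1_le4; have e0 := expR_gt0 (1 : R).
set q := expR 1 / (11 * 2 ^+ k).
have q0 : 0 < q by rewrite divr_gt0// mulr_gt0.
have q1 : q <= 1 by rewrite ler_pdivrMr ?mulr_gt0// mul1r; nra.
have : q `^ m <= q ^+ d.+1.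
  rewrite -powR_mulrn ?(ltW q0)//.
  have /= le_exp := @ger_powR R q (introT andP (conj q0 q1)).
  by apply: le_exp; rewrite -natr1.
move/(ler_wpM2r (_ : 0 <= (2 ^+ k.+1) ^+ d)) => /(_ (exprn_ge0 _ _)) h.
apply: (le_trans (h _)); first by rewrite exprn_ge0.
rewrite exprS -mulrA -exprMn.
rewrite [X in X ^+ d](_ : _ = 2 * expR 1 / 11); last first.
  by rewrite /q exprS; field; rewrite gt_eqF.
have : (2 * expR 1 / 11) ^+ d <= 1 :> R.
  by rewrite exprn_ile1//; nra.
have : q <= 2^-1 * 2^-1 ^+ k.
  rewrite /q ler_pdivrMr ?mulr_gt0// exprVn.
  rewrite [leRHS](_ : _ = 11 / 2); first nra.
  by field; rewrite gt_eqF.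
by move=> h1 h2; apply: le_trans h1; rewrite ler_piMr// ltW.
Qed.

End lattice_sums.

Section affinity_sums.
Context {R : realType} {d : nat}.
Implicit Types (v t : 'rV[R]_d) (z : 'rV[int]_d) (eps r m s : R).

Let pi_le4 : pi <= 4 :> R.
Proof. by have := pihalf_lt2 R; lra. Qed.

(** On the shell the exponent of the Gaussian is at least - m, and the factor e^m
    in front compensates for it. *)
Lemma shell_pow_le r m (N : R) (k : nat) : 0 < r -> 0 < m ->
  2 ^+ k * r < N <= 2 ^+ k.+1 * r ->
  (r / (11 * N)) `^ m <=
  (expR 1 / (11 * 2 ^+ k)) `^ m * expR (- (m / (2 ^+ k.+1 * r) ^+ 2 * N ^+ 2)).
Proof.
move=> r0 m0 /andP[kN Nk].
have p0 j : 0 < 2 ^+ j :> R by rewrite exprn_gt0.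
have N0 : 0 < N by apply: lt_trans kN; rewrite mulr_gt0.
apply: (@le_trans _ _ ((11 * 2 ^+ k)^-1 `^ m)).
  apply: ge0_ler_powR; rewrite ?nnegrE ?(ltW m0) ?divr_ge0 ?mulr_ge0//;
    do ?exact: ltW.
  rewrite ler_pdivrMr ?mulr_gt0// mulrC ler_pdivlMr ?mulr_gt0//.
  by nra.
rewrite [X in X `^ m * _]mulrC powRM ?expR_ge0 ?invr_ge0 ?mulr_ge0 ?(ltW (p0 k))// -mulrA.
rewrite ler_peMr ?powR_ge0// -expRM mul1r -expRD.
rewrite -[leLHS](@expR0 R) ler_expR subr_ge0.
rewrite mulrAC ler_pdivrMr ?exprn_gt0 ?mulr_gt0// ler_pM2l//.
by rewrite ler_sqr ?nnegrE// ltW// mulr_gt0.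
Qed.

Lemma tail_sum_le v t eps r m (S : seq 'rV[int]_d) : 0 < eps -> 0 < r ->
  d%:R + 1 <= m -> uniq S ->
  (forall z, z \in S -> r < enorm (lattice_point v eps z - t)) ->
  \sum_(z <- S) (r / (11 * enorm (lattice_point v eps z - t))) `^ m <=
  (1 + 4 * r / (eps * Num.sqrt m)) ^+ d.
Proof.
move=> eps0 r0 dm uS rS.
have m0 : 0 < m by apply: lt_le_trans dm; rewrite ltr_wpDl.
pose N z := enorm (lattice_point v eps z - t).
have /choice[kap kapP] z : exists k : nat,
    z \in S -> 2 ^+ k * r < N z <= 2 ^+ k.+1 * r.
  have [zS|zS] := boolP (z \in S); last by exists 0%N.
  have : 1 < N z / r by rewrite ltr_pdivlMr// mul1r; exact: rS.
  move=> /dyadic_shell[k]; rewrite ltr_pdivlMr// ler_pdivrMr// => kP.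
  by exists k.
pose K := (\sum_(z <- S) kap z).+1.
pose w k := (expR 1 / (11 * 2 ^+ k)) `^ m : R.
pose s k := m / (2 ^+ k.+1 * r) ^+ 2.
have s0 k : 0 < s k by rewrite divr_gt0// exprn_gt0// mulr_gt0// exprn_gt0.
apply: (@le_trans _ _ (\sum_(z <- S) \sum_(k < K)
    w k * expR (- (s k * N z ^+ 2)))).
  rewrite big_seq [leRHS]big_seq; apply: ler_sum => z zS.
  have zK : (kap z < K)%N by rewrite ltnS /K (big_rem z zS) leq_addr.
  rewrite (bigD1 (Ordinal zK)) //=.
  apply: (le_trans (shell_pow_le r0 m0 (kapP z zS))).
  rewrite lerDl; apply: sumr_ge0 => k _.
  by rewrite mulr_ge0 ?powR_ge0 ?expR_ge0.
rewrite exchange_big /=.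
set H := 1 + _.
have H0 : 0 <= H by rewrite addr_ge0// divr_ge0 ?mulr_ge0 ?sqrtr_ge0 ?ltW.
apply: (@le_trans _ _ (\sum_(k < K) (2^-1 * 2^-1 ^+ k) * H ^+ d)).
  apply: ler_sum => k _; rewrite -mulr_sumr.
  apply: (le_trans (ler_wpM2l _ (gauss_sum_le v t eps0 (s0 k) uS))).
    exact: powR_ge0.
  apply: (@le_trans _ _ (w k * (2 ^+ k.+1 * H) ^+ d)).
    rewrite ler_wpM2l ?powR_ge0// lerXn2r ?nnegrE//.
    - by rewrite addr_ge0// divr_ge0 ?pi_ge0// mulr_ge0 ?sqrtr_ge0// ltW.
    - by rewrite mulr_ge0// exprn_ge0.
    have P1 : 1 <= 2 ^+ k.+1 :> R by rewrite exprn_ege1// ler1n.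
    have P0 : 0 < 2 ^+ k.+1 :> R by rewrite exprn_gt0.
    have q0 : 0 < Num.sqrt m by rewrite sqrtr_gt0.
    have -> : Num.sqrt (s k) = Num.sqrt m / (2 ^+ k.+1 * r).
      rewrite /s sqrtrM ?(ltW m0)// sqrtrV ?sqr_ge0// sqrtr_sqr ger0_norm//.
      by rewrite mulr_ge0// ltW.
    rewrite /H mulrDr mulr1 lerD//.
    rewrite [leLHS](_ : _ = 2 ^+ k.+1 * (pi * r / (eps * Num.sqrt m))); last first.
      by field; rewrite !gt_eqF.
    rewrite ler_pM2l// ler_wpM2r//; last by rewrite ler_wpM2r// ltW.
    by rewrite invr_ge0 mulr_ge0// ltW.
  rewrite exprMn mulrA ler_wpM2r ?exprn_ge0//.
  exact: shell_weight_le.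
rewrite -mulr_suml -mulr_sumr ler_piMl ?exprn_ge0//.
by have := @sum_half_pow_le2 R K; lra.
Qed.

(** The near terms sum to at most G^d because pi <= 2 sqrt pi, the far terms to at
    most H^d with m = b n / 2, and G^d + H^d <= 2 G^d H^d <= e^(3/2) G^d H^d. *)
Lemma affinity_sum_le n v (ts tts : 'rV[R]_d) (r a b c eps : R)
    (alpha : 'rV[int]_d -> R) (S : seq 'rV[int]_d) :
  0 < eps -> 0 < a -> 0 < b -> 0 < c ->
  11 * a `^ b^-1 <= r -> 2 * (d%:R + 1) / b <= n%:R -> uniq S ->
  (forall z, z \in S -> 0 <= alpha z) ->
  (forall z, z \in S -> r < enorm (lattice_point v eps z - ts) ->
     alpha z <= a / enorm (lattice_point v eps z - ts) `^ b) ->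
  (forall z, z \in S -> enorm (lattice_point v eps z - ts) <= r ->
     alpha z <= expR (- (c * enorm (lattice_point v eps z - tts) ^+ 2))) ->
  \sum_(z <- S) Num.sqrt (alpha z) ^+ n <=
  expR (3 / 2) *
  (1 + 2 * Num.sqrt (2 * pi) / (eps * Num.sqrt (n%:R * c))) ^+ d *
  (1 + 4 * Num.sqrt 2 * r / (eps * Num.sqrt (n%:R * b))) ^+ d.
Proof.
move=> eps0 a0 b0 c0 har hn uS al0 hout hin.
pose far z := r < enorm (lattice_point v eps z - ts).
pose m := b * n%:R / 2.
have dm : d%:R + 1 <= m.
  by move: hn; rewrite ler_pdivrMr// /m; lra.
have m0 : 0 < m by apply: lt_le_trans dm; rewrite ltr_wpDl.
have n0 : 0 < n%:R :> R by move: m0; rewrite /m pmulr_lgt0// pmulr_rgt0.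
have rho0 : 0 < a `^ b^-1 by apply: powR_gt0.
have r0 : 0 < r by apply: lt_le_trans har; rewrite mulr_gt0.
rewrite (bigID far) /=.
set G := 1 + 2 * _ / _; set H := 1 + 4 * _ * _ / _.
have G1 : 1 <= G ^+ d.
  by rewrite exprn_ege1// lerDl divr_ge0 ?mulr_ge0 ?sqrtr_ge0 ?ltW.
have H1 : 1 <= H ^+ d.
  by rewrite exprn_ege1// lerDl divr_ge0 ?mulr_ge0 ?sqrtr_ge0 ?ltW.
have hfar : \sum_(z <- S | far z) Num.sqrt (alpha z) ^+ n <= H ^+ d.
  rewrite -big_filter.
  have -> : H = 1 + 4 * r / (eps * Num.sqrt m).
    rewrite /H; congr (1 + _).
    rewrite (_ : n%:R * b = 2 * m); last by rewrite /m; field.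
    rewrite sqrtrM//; field.
    by rewrite !gt_eqF// sqrtr_gt0.
  have farS z : z \in [seq z <- S | far z] -> far z.
    by rewrite mem_filter => /andP[].
  apply: (le_trans _ (tail_sum_le eps0 r0 dm (filter_uniq _ uS) farS)).
  rewrite big_seq [leRHS]big_seq; apply: ler_sum => z.
  rewrite mem_filter => /andP[farz zS].
  set Nz := enorm _.
  have Nz0 : 0 < Nz by exact: lt_trans farz.
  have rhoE : a / Nz `^ b = (a `^ b^-1 / Nz) `^ b.
    rewrite powRM ?invr_ge0 ?ltW// -powRrM mulVf ?gt_eqF// powRr1 ?ltW//.
    by rewrite -[Nz^-1]powR_inv1 ?ltW// -powRrM mulN1r powRN.
  apply: (@le_trans _ _ ((a `^ b^-1 / Nz) `^ m)).
    rewrite /m (_ : b * n%:R / 2 = b * 2^-1 * n%:R); last by ring.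
    rewrite powRrM powR_mulrn ?powR_ge0// lerXn2r ?nnegrE ?sqrtr_ge0 ?powR_ge0//.
    rewrite powRrM powR12_sqrt ?powR_ge0// ler_wsqrtr// -rhoE.
    exact: hout.
  apply: ge0_ler_powR; rewrite ?nnegrE ?(ltW m0)//.
  - by rewrite divr_ge0 ?ltW.
  - by rewrite divr_ge0 ?mulr_ge0 ?ltW.
  rewrite invfM mulrA ler_wpM2r ?invr_ge0 ?(ltW Nz0)//.
  by rewrite ler_pdivlMr// mulrC.
have hnear : \sum_(z <- S | ~~ far z) Num.sqrt (alpha z) ^+ n <= G ^+ d.
  rewrite -big_filter.
  pose s := n%:R * c / 2.
  have s0 : 0 < s by rewrite divr_gt0 ?mulr_gt0.
  apply: (@le_trans _ _ ((1 + pi / (eps * Num.sqrt s)) ^+ d)).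
    apply: le_trans (gauss_sum_le v tts eps0 s0 (filter_uniq _ uS)).
    rewrite big_seq [leRHS]big_seq; apply: ler_sum => z.
    rewrite mem_filter => /andP[/negP nfar zS].
    set Nz := enorm _.
    have le_r : enorm (lattice_point v eps z - ts) <= r.
      by rewrite leNgt; apply/negP.
    apply: (@le_trans _ _ (Num.sqrt (expR (- (c * Nz ^+ 2))) ^+ n)).
      by rewrite lerXn2r ?nnegrE ?sqrtr_ge0// ler_wsqrtr// hin.
    rewrite -powR12_sqrt ?expR_ge0// -expRM -expRM_natl ler_expR /s -mulr_natl.
    by rewrite le_eqVlt; apply/orP; left; apply/eqP; field.
  rewrite lerXn2r ?nnegrE ?addr_ge0 ?divr_ge0 ?mulr_ge0 ?sqrtr_ge0 ?pi_ge0//;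
    do ?exact: ltW.
  have nc0 : 0 <= n%:R * c by rewrite mulr_ge0 ?ltW.
  rewrite /G lerD2l /s (sqrtrM 2^-1 nc0) sqrtrV// (sqrtrM pi)//.
  have p2 : 0 < Num.sqrt 2 :> R by rewrite sqrtr_gt0.
  have p22 : Num.sqrt 2 ^+ 2 = 2 :> R by rewrite sqr_sqrtr.
  have pp : 0 < Num.sqrt pi :> R by rewrite sqrtr_gt0 pi_gt0.
  have ppp : Num.sqrt pi ^+ 2 = pi :> R by rewrite sqr_sqrtr ?pi_ge0.
  have pl : Num.sqrt pi <= 2 :> R.
    have : Num.sqrt pi ^+ 2 <= 2 ^+ 2 :> R by rewrite ppp; have := pi_le4; lra.
    by rewrite ler_sqr ?nnegrE// ltW.
  have pc : 0 < Num.sqrt (n%:R * c) by rewrite sqrtr_gt0 mulr_gt0.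
  rewrite [leLHS](_ : _ = pi * Num.sqrt 2 / (eps * Num.sqrt (n%:R * c))); last first.
    by field; rewrite ?gt_eqF.
  rewrite ler_wpM2r ?invr_ge0 ?mulr_ge0 ?(ltW eps0) ?(ltW pc)//.
  rewrite -[in leLHS]ppp.
  have : 0 <= Num.sqrt 2 * (Num.sqrt pi * (2 - Num.sqrt pi)) :> R.
    by rewrite !mulr_ge0 ?subr_ge0.
  by lra.
have e2 : 2 <= expR (3 / 2) :> R by apply: le_trans (expR_ge1Dx _); lra.
apply: (le_trans (lerD hfar hnear)).
rewrite -mulrA.
move: (G ^+ d) (H ^+ d) G1 H1 => x y x1 y1.
apply: (@le_trans _ _ (2 * (x * y))); first nra.
by rewrite ler_wpM2r// mulr_ge0//; lra.
Qed.

End affinity_sums.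

(** * Integration against densities and independent samples *)

Section integral_from_indicators.
Local Open Scope ereal_scope.
Context {d1 d2} {W : measurableType d1} {T : measurableType d2} {R : realType}.
Variables (nu : {measure set W -> \bar R}) (m : {measure set T -> \bar R}).
Variables (Y : W -> T) (g : W -> R) (c : R).
Hypotheses (mY : measurable_fun [set: W] Y) (mg : measurable_fun [set: W] g).
Hypothesis (g0 : forall w, (0 <= g w)%R).
Hypothesis indicH : forall B : set T, measurable B ->
  \int[nu]_w (\1_B (Y w) * g w)%:E = c%:E * m B.

Import HBNNSimple.

Let mgE : measurable_fun [set: W] (EFin \o g).
Proof. exact/measurable_EFinP. Qed.

Let measurable_compY (u : T -> \bar R) : measurable_fun [set: T] u ->
  measurable_fun [set: W] (u \o Y).
Proof. by move=> mu; exact: measurableT_comp. Qed.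

Let nnsfun_case (h : {nnsfun T >-> R}) :
  \int[nu]_w ((h (Y w))%:E * (g w)%:E) = c%:E * \int[m]_x (h x)%:E.
Proof.
pose lvl k : set T := h @^-1` [set k].
have mlvl k : measurable (lvl k) by rewrite /lvl.
have mind k : measurable_fun [set: T] (EFin \o (fun x => k * \1_(lvl k) x)%R).
  by apply/measurable_EFinP; exact: measurable_funM.
have ind0 k x : 0 <= (k * \1_(lvl k) x)%:E by exact: nnfun_muleindic_ge0.
have hE x : (h x)%:E = \sum_(k \in range h) (k * \1_(lvl k) x)%:E.
  by rewrite fsumEFin// -fimfunE.
transitivity (\int[nu]_w
    \sum_(k \in range h) ((k * \1_(lvl k) (Y w))%:E * (g w)%:E)).
  by apply: eq_integral => w _; rewrite hE ge0_mule_fsuml.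
rewrite ge0_integral_fsum//; last 2 first.
- by move=> k; apply: emeasurable_funM => //; exact: (measurable_compY (mind k)).
- by move=> k w _; rewrite mule_ge0// lee_fin.
under [in RHS]eq_integral do rewrite hE.
rewrite ge0_integral_fsum// ge0_mule_fsumr; last first.
  by move=> k; apply: integral_ge0.
apply: eq_fsbigr => k _.
have [k0|k0] := leP 0%R k; last first.
  have lvl0 : lvl k = set0 by rewrite /lvl preimage_nnfun0.
  rewrite lvl0; under eq_integral do rewrite indic0 mulr0 mul0e.
  rewrite integral0; under eq_integral do rewrite indic0 mulr0.
  by rewrite integral0 mule0.
transitivity (k%:E * \int[nu]_w (\1_(lvl k) (Y w) * g w)%:E).
  rewrite -ge0_integralZl//.
  - by apply: eq_integral => w _; rewrite -!EFinM mulrA.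
  - apply/measurable_EFinP; apply: measurable_funM => //.
    by apply: measurableT_comp.
  - by move=> w _; rewrite lee_fin mulr_ge0.
rewrite indicH// muleCA; congr (_ * _).
by rewrite integralZl_indic_nnsfun// integral_indic// setIT.
Qed.

(** Both sides are additive and continuous along increasing sequences in f, so
    the case of indicators propagates through simple functions. *)
Lemma ge0_integral_from_indicators (f : T -> \bar R) :
  measurable_fun [set: T] f -> (forall x, 0 <= f x) ->
  \int[nu]_w (f (Y w) * (g w)%:E) = c%:E * \int[m]_x f x.
Proof.
move=> mf f0; pose f_ := nnsfun_approx measurableT mf.
have f_cvg x : (fun n => (f_ n x)%:E) @ \oo --> f x.
  by apply: cvg_nnsfun_approx.
have mf_ n : measurable_fun [set: T] (EFin \o f_ n).
  by apply/measurable_EFinP.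
have nd_f_ x : {homo (fun n => (f_ n x)%:E) : a b / (a <= b)%N >-> a <= b}.
  by move=> a b ab; rewrite lee_fin; exact/lefP/nd_nnsfun_approx.
have cvgl : \int[nu]_w ((f_ n (Y w))%:E * (g w)%:E) @[n --> \oo] -->
    \int[nu]_w (f (Y w) * (g w)%:E).
  have -> : \int[nu]_w (f (Y w) * (g w)%:E) =
      \int[nu]_w (limn (fun n => (f_ n (Y w))%:E * (g w)%:E)).
    by apply: eq_integral => w _; apply/esym/cvg_lim => //; exact: cvgeZr.
  apply: cvg_monotone_convergence => //.
  - by move=> n; apply: emeasurable_funM => //; exact: (measurable_compY (mf_ n)).
  - by move=> n w _; rewrite mule_ge0// lee_fin.
  - by move=> w _ a b ab; rewrite lee_wpmul2r ?lee_fin//; exact: nd_f_.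
have cvgr : \int[m]_x (f_ n x)%:E @[n --> \oo] --> \int[m]_x f x.
  have -> : \int[m]_x f x = \int[m]_x (limn (fun n => (f_ n x)%:E)).
    by apply: eq_integral => x _; apply/esym/cvg_lim.
  apply: cvg_monotone_convergence => //.
  by move=> n x _; rewrite lee_fin.
apply: (cvg_unique (@ereal_hausdorff R) cvgl).
rewrite (_ : (fun n => _) = fun n => c%:E * \int[m]_x (f_ n x)%:E).
  exact: cvgeZl.
by apply/funext => n; exact: nnsfun_case.
Qed.

End integral_from_indicators.

Section densities_and_independence.
Local Open Scope ereal_scope.
Context {dT} {T : measurableType dT} {R : realType}.

(** The dominating measure is arbitrary, so the Radon-Nikodym calculus of
    sigma-finite measures does not apply. *)
Lemma is_density_integral (mu : {measure set T -> \bar R}) (P : probability T R)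
    (p : T -> R) (f : T -> \bar R) :
  is_density mu P p -> measurable_fun [set: T] f -> (forall x, 0 <= f x) ->
  \int[mu]_x (f x * (p x)%:E) = \int[P]_x f x.
Proof.
move=> [mp p0 Pp] mf f0; rewrite -[RHS]mul1e.
apply: (ge0_integral_from_indicators (Y := idfun) (g := p)) => //.
  exact: measurable_id.
move=> B mB; rewrite mul1e; apply: (etrans _ (esym (Pp B mB))).
rewrite [RHS]integral_mkcond; apply: eq_integral => x _.
rewrite patchE indicE /=.
by case: (x \in B); rewrite ?mul1r// mul0r.
Qed.

Context {dO} {Omega : measurableType dO} (Pr : probability Omega R).
Context (P : probability T R) (n : nat) (X : 'I_n -> {RV Pr >-> T}).

Lemma iid_integral (i : 'I_n) (f : T -> \bar R) : iid P X ->
  measurable_fun [set: T] f -> (forall x, 0 <= f x) ->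
  \int[Pr]_w f (X i w) = \int[P]_x f x.
Proof.
move=> [XP _] mf f0.
rewrite -[LHS](ge0_integral_distribution (X i) mf f0).
by apply: eq_measure_integral => B mB _; exact: XP.
Qed.

Lemma iid_integral_prod (f : 'I_n -> T -> R) : iid P X ->
  (forall i, measurable_fun [set: T] (f i)) -> (forall i x, (0 <= f i x)%R) ->
  (forall i, \int[P]_x (f i x)%:E \is a fin_num) ->
  \int[Pr]_w (\prod_(i < n) f i (X i w))%:E =
  (\prod_(i < n) fine (\int[P]_x (f i x)%:E))%:E.
Proof.
move=> iidX.
pose indic_from k (f : 'I_n -> T -> R) :=
  forall i : 'I_n, (k <= i)%N -> exists2 B, measurable B & f i = \1_B.
(* The factors are passed from indicators to arbitrary functions one index at
   a time. *)
suff step k g : indic_from k g ->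
    (forall i, measurable_fun [set: T] (g i)) ->
    (forall i x, (0 <= g i x)%R) ->
    (forall i, \int[P]_x (g i x)%:E \is a fin_num) ->
    \int[Pr]_w (\prod_(i < n) g i (X i w))%:E =
    (\prod_(i < n) fine (\int[P]_x (g i x)%:E))%:E.
  by apply: (step n) => i; rewrite leqNgt ltn_ord.
elim: k g => [|k IHk] g gk mg g0 gfin.
  have /choice[B BP] (i : 'I_n) : exists B, measurable B /\ g i = \1_B.
    by have [B mB gB] := gk i (leq0n i); exists B.
  transitivity (\int[Pr]_w (\1_(\bigcap_(i in [set: 'I_n]) (X i @^-1` B i)) w)%:E).
    apply: eq_integral => w _; congr EFin; rewrite indicE.
    have [wB|/negP wB] := boolP (w \in _).
      rewrite big1// => i _; rewrite (BP i).2 indicE.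
      by rewrite mem_set//; move: wB; rewrite inE => /(_ i I).
    have [i] : exists i, ~ B i (X i w).
      apply/existsNP => h; apply: wB; rewrite inE => i _; exact: h.
    move=> wBi; rewrite (bigD1 i)//= (BP i).2 indicE memNset// mul0r; exact: erefl.
  rewrite integral_indic//; last first.
    apply: fin_bigcap_measurable => // i _; rewrite -[_ @^-1` _]setTI.
    by apply: measurable_funP => //; exact: (BP i).1.
  rewrite setIT; apply: (etrans (iidX.2 B (fun i => (BP i).1))).
  rewrite -prodEFin; apply: eq_bigr => i _.
  have -> : \int[P]_x (g i x)%:E = P (B i).
    by rewrite (BP i).2 integral_indic ?setIT//; exact: (BP i).1.
  rewrite fineK ?fin_num_measure//; last exact: (BP i).1.
  exact: iidX.1 _ _ (BP i).1.
have [kn|nk] := ltnP k n; last first.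
  by apply: IHk => // i ki; have := ltn_ord i; rewrite ltnNge (leq_trans nk ki).
pose i0 := Ordinal kn.
under eq_integral do rewrite (bigD1 i0)//= EFinM.
rewrite (bigD1 i0)//= [in RHS]EFinM [RHS]muleC fineK//.
pose g_rest w := (\prod_(i < n | i != i0) g i (X i w))%R.
have mgX i : measurable_fun [set: Omega] (g i \o X i).
  exact: measurableT_comp.
apply: (@ge0_integral_from_indicators _ _ _ _ _ _ _ (X i0) g_rest _ _ _ _ _
  (EFin \o g i0)) => //.
- rewrite /g_rest (_ : (fun w => _) = fun w =>
    \prod_(i <- [seq i <- index_enum 'I_n | i != i0]) (g i \o X i) w)%R.
    by apply: measurable_prod => i _; exact: mgX.
  by apply/funext => w; rewrite big_filter.
- by move=> w; apply: prodr_ge0.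
- move=> B mB.
  pose g' i := if i == i0 then \1_B else g i.
  have gE i : i != i0 -> g' i = g i by rewrite /g' => /negPf ->.
  have gE0 : g' i0 = \1_B by rewrite /g' eqxx.
  have PB : \int[P]_x (\1_B x)%:E = P B by rewrite integral_indic// setIT.
  transitivity (\int[Pr]_w (\prod_(i < n) g' i (X i w))%:E).
    apply: eq_integral => w _; rewrite [in RHS](bigD1 i0)//= gE0.
    by under [in RHS]eq_bigr => i ii0 do rewrite gE//.
  rewrite IHk.
  + rewrite (bigD1 i0)//= gE0 PB EFinM muleC fineK ?fin_num_measure//.
    by under eq_bigr => i ii0 do rewrite gE//.
  + move=> i ki; have [->|ii0] := eqVneq i i0; first by exists B.
    rewrite gE//; apply: gk; rewrite ltn_neqAle ki andbT.
    by apply: contra_neq ii0 => ki0; exact/val_inj.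
  + move=> i; have [->|ii0] := eqVneq i i0; last by rewrite gE.
    by rewrite gE0; exact: measurable_indic.
  + by move=> i x; have [->|ii0] := eqVneq i i0; rewrite ?gE0 ?gE.
  + move=> i; have [->|ii0] := eqVneq i i0; last by rewrite gE.
    by rewrite gE0 PB fin_num_measure.
- exact/measurable_EFinP.
- by move=> x; rewrite lee_fin.
Qed.

End densities_and_independence.

Section countable_selection.
Local Open Scope ereal_scope.
Context {dO} {Omega : measurableType dO} {I : countType}.
Variable zeta : Omega -> I.
Hypothesis mzeta : forall i, measurable (zeta @^-1` [set i]).

Lemma measurable_countable_selection {dS} {S : measurableType dS}
    (G : I -> Omega -> S) : (forall i, measurable_fun [set: Omega] (G i)) ->
  measurable_fun [set: Omega] (fun w => G (zeta w) w).
Proof.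
move=> mG _ B mB; rewrite setTI.
rewrite (_ : _ @^-1` B = \bigcup_i (zeta @^-1` [set i] `&` G i @^-1` B)).
  apply: countable_bigcupT_measurable => // i; apply: measurableI => //.
  by rewrite -[_ @^-1` B]setTI; exact: mG.
apply/seteqP; split => [w Bw|w [i _ [/= -> //]]].
by exists (zeta w).
Qed.

(** Whatever index is selected, the selected term is one of the terms of the
    sum of all of them, so its expectation is at most the sum of theirs. *)
Lemma countable_selection_integral_le {R : realType}
    (mu : {measure set Omega -> \bar R}) (G : I -> Omega -> \bar R) (C : \bar R) :
  (forall i, measurable_fun [set: Omega] (G i)) -> (forall i w, 0 <= G i w) ->
  (forall s : seq I, uniq s -> \sum_(i <- s) \int[mu]_w G i w <= C) ->
  \int[mu]_w G (zeta w) w <= C.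
Proof.
move=> mG G0 GC.
pose F k : set Omega := [set w | pickle (zeta w) = k].
have FE k : F k = if pickle_inv k is Some i then zeta @^-1` [set i] else set0.
  case kE: (pickle_inv k) => [i|].
    apply/seteqP; split => w /=; rewrite /F /=.
      by move=> wk; move: kE; rewrite -wk pickleK_inv => -[].
    by move=> ->; have := @pickle_invK I k; rewrite kE.
  by rewrite -subset0 => w /= wk; move: kE; rewrite -wk pickleK_inv.
have mF k : measurable (F k).
  by rewrite FE; case: pickle_inv => [i|].
have UF : \bigcup_k F k = setT.
  by apply/seteqP; split => // w _; exists (pickle (zeta w)).
have := @ge0_integral_bigcup _ _ _ mu F (fun w => G (zeta w) w) mF.
rewrite /= UF => -> //.
- apply: lime_le.
    by apply: is_cvg_nneseries => k _ _; apply: integral_ge0.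
  apply: nearW => K.
  apply: le_trans (GC (pmap (@pickle_inv I) (iota 0 K)) _).
    rewrite big_pmap /index_iota subn0; apply: lee_sum => k _.
    rewrite FE; case: pickle_inv => [i|]; last by rewrite integral_set0.
    rewrite (eq_integral (G i)); last by move=> w; rewrite inE /= => ->.
    exact: ge0_subset_integral.
  by apply: (pmap_uniq (@pickle_invK I)); exact: iota_uniq.
- exact: measurable_countable_selection.
- by move=> k j _ _ [w [/= <- <-]].
Qed.

End countable_selection.

(** * Likelihood ratios of two densities *)

Definition loglr {T : Type} {R : realType} (p q : T -> R) (x : T) : \bar R :=
  lne ((p x)%:E / (q x)%:E)%E.

Definition root_ratio {T : Type} {R : realType} (p q : T -> R) (x : T) : R :=
  Num.sqrt (q x / p x).

Lemma measurable_fun_powR {dT} {T : measurableType dT} {R : realType}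
    (f : T -> R) (a : R) :
  measurable_fun [set: T] f -> measurable_fun [set: T] (fun x => f x `^ a).
Proof. by move=> mf; exact: (measurableT_comp (measurable_powR a)). Qed.

Lemma is_density_total {dT} {T : measurableType dT} {R : realType}
    (mu : {measure set T -> \bar R}) (P : probability T R) (p : T -> R) :
  is_density mu P p -> (\int[mu]_x (p x)%:E = 1)%E.
Proof.
by move=> [_ _ Pp]; exact: (etrans (esym (Pp _ measurableT)) (probability_setT P)).
Qed.

Section two_densities.
Context {dT} {T : measurableType dT} {R : realType}.
Variables (mu : {measure set T -> \bar R}) (P Q : probability T R).
Variables (p q : T -> R).
Hypotheses (hp : is_density mu P p) (hq : is_density mu Q q).

Let p_ge0 x : 0 <= p x. Proof. by case: hp. Qed.
Let q_ge0 x : 0 <= q x. Proof. by case: hq. Qed.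
Let mp : measurable_fun [set: T] p. Proof. by case: hp. Qed.
Let mq : measurable_fun [set: T] q. Proof. by case: hq. Qed.

Lemma loglrE x : loglr p q x =
  if p x <= 0 then -oo%E else if q x <= 0 then +oo%E
  else (ln (p x) - ln (q x))%:E.
Proof.
rewrite /loglr; have [p0|p0] := leP (p x) 0.
  have -> : p x = 0 by apply/eqP; rewrite eq_le p0 p_ge0.
  by rewrite mul0e le0_lneNy.
have [q0|q0] := leP (q x) 0.
  have -> : q x = 0 by apply/eqP; rewrite eq_le q0 q_ge0.
  by rewrite inve0 gt0_muley ?lte_fin.
rewrite inver gt_eqF// -EFinM lne_EFin ?divr_gt0//.
by rewrite ln_div ?posrE.
Qed.

Lemma loglr_fin_num x : loglr p q x \is a fin_num ->
  [/\ 0 < p x, 0 < q x & loglr p q x = (ln (p x) - ln (q x))%:E].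
Proof.
rewrite loglrE; have [//|p0] := leP (p x) 0.
by have [//|q0] := leP (q x) 0; split.
Qed.

Lemma measurable_loglr : measurable_fun [set: T] (loglr p q).
Proof.
rewrite (_ : loglr p q = fun x => if p x <= 0 then -oo%E
  else if q x <= 0 then +oo%E else (ln (p x) - ln (q x))%:E); last first.
  by apply/funext => x; exact: loglrE.
apply: measurable_fun_ifT => //; first exact: measurable_fun_ler.
apply: measurable_fun_ifT => //; first exact: measurable_fun_ler.
apply/measurable_EFinP; apply: measurable_funB.
  by apply: measurableT_comp mp; exact: measurable_ln.
by apply: measurableT_comp mq; exact: measurable_ln.
Qed.

Lemma measurable_root_ratio : measurable_fun [set: T] (root_ratio p q).
Proof.
rewrite (_ : root_ratio p q = fun x => (q x * p x `^ (-1)) `^ 2^-1).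
  apply: measurable_fun_powR; apply: measurable_funM => //.
  exact: measurable_fun_powR.
apply/funext => x; rewrite powR_inv1// powR12_sqrt//.
by rewrite divr_ge0.
Qed.

Local Open Scope ereal_scope.

Let neg_le x : (loglr p q)^\- x * (p x)%:E <= (q x)%:E.
Proof.
rewrite funenegE loglrE; have [p0|p0] := leP (p x) 0%R.
  have -> : p x = 0%R by apply/eqP; rewrite eq_le p0 p_ge0.
  by rewrite mule0 lee_fin.
have [q0|q0] := leP (q x) 0%R.
  by rewrite /= maxNye mul0e lee_fin.
rewrite -EFinN -EFin_max -EFinM lee_fin maxr_pMl ?(ltW p0)// mul0r.
rewrite ge_max q_ge0 andbT opprB -ler_pdivlMr//.
have -> : (ln (q x) - ln (p x) = ln (1 + (q x / p x - 1)))%R.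
  by rewrite addrCA subrr addr0 ln_div ?posrE.
apply: (le_trans (le_ln1Dx _)); last by rewrite gerBl.
by rewrite ltrBDr addNr divr_gt0.
Qed.

Lemma loglr_integral : \int[P]_x loglr p q x = rel_entropy mu p q.
Proof.
have mul_pos x : ((fun x => (p x)%:E * loglr p q x)^\+ x =
    (loglr p q)^\+ x * (p x)%:E).
  by rewrite !funeposE muleC maxe_pMl ?lee_fin// mul0e.
have mul_neg x : ((fun x => (p x)%:E * loglr p q x)^\- x =
    (loglr p q)^\- x * (p x)%:E).
  by rewrite !funenegE muleC maxe_pMl ?lee_fin// mul0e mulNe.
rewrite [LHS]integralE /rel_entropy [RHS]integralE; congr (_ - _).
  under [RHS]eq_integral do rewrite mul_pos.
  apply/esym; apply: (is_density_integral hp) => //.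
  exact/measurable_funepos/measurable_loglr.
under [RHS]eq_integral do rewrite mul_neg.
apply/esym; apply: (is_density_integral hp) => //.
exact/measurable_funeneg/measurable_loglr.
Qed.

(** The negative part is always integrable: p times it is at most q, because
    log (q / p) <= q / p - 1. *)
Lemma loglr_integrable : rel_entropy mu p q < +oo ->
  P.-integrable [set: T] (loglr p q).
Proof.
move=> Dfin.
have mneg := measurable_funeneg measurable_loglr.
have mpos := measurable_funepos measurable_loglr.
have neg1 : \int[P]_x (loglr p q)^\- x < +oo.
  rewrite -(is_density_integral hp)//.
  apply: (@le_lt_trans _ _ (\int[mu]_x (q x)%:E)).
    apply: ge0_le_integral => //.
    - by move=> x _; rewrite mule_ge0// lee_fin.
    - by apply: emeasurable_funM => //; exact/measurable_EFinP.
    - exact/measurable_EFinP.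
  by rewrite (is_density_total hq) ltry.
have pos1 : \int[P]_x (loglr p q)^\+ x < +oo.
  move: Dfin; rewrite -loglr_integral integralE.
  have : 0 <= \int[P]_x (loglr p q)^\- x by exact: integral_ge0.
  move: neg1.
  case: (\int[P]_x (loglr p q)^\- x) => [r| |]//= _ _.
  case: (\int[P]_x (loglr p q)^\+ x) => [s _|//|_]; first exact: ltry.
  by rewrite ltNye.
apply/integrableP; split; first exact: measurable_loglr.
apply: (@le_lt_trans _ _ (\int[P]_x ((loglr p q)^\+ x + (loglr p q)^\- x))).
  rewrite le_eqVlt; apply/orP; left; apply/eqP; apply: eq_integral => x _.
  exact: (congr1 (fun f => f x) (fune_abse _)).
by rewrite ge0_integralD//; exact: lte_add_pinfty.
Qed.

Lemma affinityE : affinity mu p q = \int[P]_x (root_ratio p q x)%:E.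
Proof.
rewrite -(is_density_integral hp); first last.
- by move=> x; rewrite lee_fin sqrtr_ge0.
- exact/measurable_EFinP/measurable_root_ratio.
apply: eq_integral => x _; rewrite -EFinM; congr EFin.
rewrite /root_ratio; have [p0|p0] := leP (p x) 0%R.
  have -> : p x = 0%R by apply/eqP; rewrite eq_le p0 p_ge0.
  by rewrite mul0r sqrtr0 mulr0.
rewrite -{3}(ger0_norm (ltW p0)) -sqrtr_sqr -sqrtrM ?divr_ge0//; congr Num.sqrt.
by field; rewrite gt_eqF.
Qed.

Lemma affinity_ge0 : 0 <= affinity mu p q.
Proof. by apply: integral_ge0 => x _; rewrite lee_fin sqrtr_ge0. Qed.

Lemma affinity_le1 : affinity mu p q <= 1.
Proof.
apply: (@le_trans _ _ (\int[mu]_x (2^-1%:E * ((p x)%:E + (q x)%:E)))).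
  apply: ge0_le_integral => //.
  - apply/measurable_EFinP.
    rewrite (_ : (fun x => _) = fun x => ((p x * q x) `^ 2^-1)%R).
      by apply: measurable_fun_powR; exact: measurable_funM.
    by apply/funext => x; rewrite powR12_sqrt// mulr_ge0.
  - by apply/measurable_EFinP; apply: measurable_funM => //; exact: measurable_funD.
  - move=> x _; rewrite -EFinD -EFinM lee_fin.
    rewrite -ler_sqr ?nnegrE ?sqrtr_ge0 ?mulr_ge0 ?addr_ge0//.
    rewrite sqr_sqrtr ?mulr_ge0// -subr_ge0.
    rewrite [X in (0 <= X)%R](_ : _ = ((p x - q x) / 2) ^+ 2)%R ?sqr_ge0//.
    by field.
rewrite ge0_integralZl//; last 2 first.
- by apply/measurable_EFinP; exact: measurable_funD.
- by move=> x _; rewrite adde_ge0// lee_fin.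
rewrite ge0_integralD//; do ?[exact/measurable_EFinP|by move=> x _; rewrite lee_fin].
rewrite (is_density_total hp) (is_density_total hq) -EFinD -EFinM lee_fin.
by lra.
Qed.

End two_densities.

(** * The penalized maximum likelihood estimator *)

Lemma ln_prodr {R : realType} (I : Type) (s : seq I) (F : I -> R) :
  (forall i, 0 < F i) -> ln (\prod_(i <- s) F i) = \sum_(i <- s) ln (F i).
Proof.
move=> F0; elim: s => [|i s IHs]; first by rewrite !big_nil ln1.
by rewrite !big_cons lnM ?posrE ?prodr_gt0// IHs.
Qed.

Lemma sum_lne_eqNy {R : realType} (n : nat) (u : 'I_n -> R) (i : 'I_n) :
  u i <= 0 -> (\sum_(j < n) lne (u j)%:E = -oo)%E.
Proof.
move=> ui; apply/eqP; rewrite esum_eqNy; apply/existsP; exists i.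
by rewrite le0_lneNy// lee_fin.
Qed.

Section pointwise.
Context {dT} {T : measurableType dT} {R : realType} {d n : nat}.
Variable mu : {measure set T -> \bar R}.
Variables (p : T -> R) (pt : 'rV[R]_d -> T -> R) (L : 'rV[R]_d -> R).
Variables (Theta_eps : set 'rV[R]_d) (that : n.-tuple T -> 'rV[R]_d).
Hypothesis hthat : is_penalized_mle Theta_eps pt L that.
Variables (x : n.-tuple T) (theta : 'rV[R]_d).
Hypothesis Theta_theta : Theta_eps theta.
Hypothesis pt_gt0 : forall i, 0 < pt theta (tnth x i).

(** Otherwise the estimator would have penalized log-likelihood -oo, which the
    competitor theta beats. *)
Lemma penalized_mle_gt0 i : 0 < pt (that x) (tnth x i).
Proof.
case: hthat => _ /(_ x theta Theta_theta) + _.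
rewrite ltNge => le_pen; apply/negP => q0; move: le_pen.
rewrite /penalized_loglik [X in (_ <= X - _)%E -> _](@sum_lne_eqNy _ _ _ i)//.
rewrite (eq_bigr (fun j => (ln (pt theta (tnth x j)))%:E)); last first.
  by move=> j _; rewrite lne_EFin.
by rewrite sumEFin.
Qed.

Lemma penalized_mle_le :
  \sum_(i < n) ln (pt theta (tnth x i)) - L theta <=
  \sum_(i < n) ln (pt (that x) (tnth x i)) - L (that x).
Proof.
case: hthat => _ /(_ x theta Theta_theta) + _; rewrite /penalized_loglik.
rewrite (eq_bigr (fun j => (ln (pt theta (tnth x j)))%:E)); last first.
  by move=> j _; rewrite lne_EFin.
rewrite [X in (_ <= X - _)%E -> _](eq_bigr (fun j => (ln (pt (that x) (tnth x j)))%:E)).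
  by rewrite !sumEFin -!EFinB lee_fin.
by move=> j _; rewrite lne_EFin// penalized_mle_gt0.
Qed.

Lemma root_ratio_gt0 i : 0 < p (tnth x i) ->
  0 < root_ratio p (pt (that x)) (tnth x i).
Proof. by move=> p0; rewrite sqrtr_gt0 divr_gt0// penalized_mle_gt0. Qed.

Hypothesis p_gt0 : forall i, 0 < p (tnth x i).
Variables (alpha C : R).
Hypotheses (alpha_gt0 : 0 < alpha) (C_gt0 : 0 < C).

Let Y : R := (\prod_(i < n) root_ratio p (pt (that x)) (tnth x i)) /
  Num.sqrt alpha ^+ n.

Let ln_sqrt (y : R) : 0 < y -> ln (Num.sqrt y) = ln y / 2.
Proof. by move=> y0; rewrite -powR12_sqrt ?ltW// ln_powR mulrC. Qed.

(** Half of the log-likelihood ratio is the logarithm of the product of the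
    root ratios, and ln (Y / C) <= Y / C - 1 linearizes the remaining term. *)
Lemma pointwise_bound :
  - (n%:R * ln alpha) + L (that x) <=
  2 / C * Y + (2 * ln C - 2 + L theta +
    \sum_(i < n) (ln (p (tnth x i)) - ln (pt theta (tnth x i)))).
Proof.
have Z0 : 0 < \prod_(i < n) root_ratio p (pt (that x)) (tnth x i).
  by apply: prodr_gt0 => i _; exact: root_ratio_gt0.
have s0 : 0 < Num.sqrt alpha ^+ n by rewrite exprn_gt0// sqrtr_gt0.
have Y0 : 0 < Y by rewrite divr_gt0.
have lnY : 2 * ln Y = \sum_(i < n) (ln (pt (that x) (tnth x i)) - ln (p (tnth x i)))
    - n%:R * ln alpha.
  rewrite /Y ln_div ?posrE// lnXn ?sqrtr_gt0// ln_sqrt// mulrBr; congr (_ - _).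
    rewrite ln_prodr => [|i]; last exact: root_ratio_gt0.
    rewrite mulr_sumr; apply: eq_bigr => i _.
    have q0 := penalized_mle_gt0 i.
    by rewrite /root_ratio ln_sqrt ?divr_gt0// ln_div ?posrE//; field.
  by rewrite -mulr_natl; field.
have lnYC : 2 * ln Y - 2 * ln C <= 2 / C * Y - 2.
  have -> : 2 * ln Y - 2 * ln C = 2 * ln (1 + (Y / C - 1)).
    by rewrite addrCA subrr addr0 ln_div ?posrE//; ring.
  have : ln (1 + (Y / C - 1)) <= Y / C - 1.
    by apply: le_ln1Dx; rewrite ltrBDr addNr divr_gt0.
  by lra.
have := penalized_mle_le; move: lnYC; rewrite lnY !sumrB.
by lra.
Qed.

End pointwise.

Section tilted_likelihood_ratio.
Local Open Scope ereal_scope.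
Context {dT} {T : measurableType dT} {R : realType}.
Context {dO} {Omega : measurableType dO} (Pr : probability Omega R).
Variables (mu : {measure set T -> \bar R}) (P Q : probability T R).
Variables (p q : T -> R) (n : nat) (X : 'I_n -> {RV Pr >-> T}).
Hypotheses (hp : is_density mu P p) (hq : is_density mu Q q).
Hypothesis hX : iid P X.

Lemma loglr_sample_integrable (i : 'I_n) : rel_entropy mu p q < +oo ->
  Pr.-integrable [set: Omega] (fun w => loglr p q (X i w)).
Proof.
move=> /(loglr_integrable hp hq)/integrableP[ml lfin].
apply/integrableP; split; first exact: measurableT_comp.
apply: le_lt_trans lfin.
rewrite -(iid_integral i hX)//.
by apply: measurableT_comp ml; exact: abse_measurable.
Qed.

Lemma loglr_sample_integral (i : 'I_n) :
  \int[Pr]_w loglr p q (X i w) = rel_entropy mu p q.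
Proof.
have ml := measurable_loglr hp hq.
rewrite -(loglr_integral hp hq) [LHS]integralE [RHS]integralE; congr (_ - _).
  rewrite -(iid_integral i hX)//; last exact: measurable_funepos.
  by apply: eq_integral => w _; rewrite !funeposE.
rewrite -(iid_integral i hX)//; last exact: measurable_funeneg.
by apply: eq_integral => w _; rewrite !funenegE.
Qed.

Variable alpha : R.
Hypotheses (affE : affinity mu p q = alpha%:E) (n0 : (0 < n)%N).

(** The inverse is taken in the extended reals, so that when alpha = 0 a
    sample of positive likelihood ratio gets the value +oo; as the expectation
    is finite, such samples are negligible. *)
Definition tilted_lr (w : Omega) : \bar R :=
  (\prod_(i < n) root_ratio p q (X i w))%:E * (Num.sqrt alpha ^+ n)%:E^-1.

Lemma tilted_lr_ge0 w : 0 <= tilted_lr w.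
Proof.
rewrite mule_ge0 ?inve_ge0 ?lee_fin ?exprn_ge0 ?sqrtr_ge0//.
by apply: prodr_ge0 => i _; exact: sqrtr_ge0.
Qed.

Let measurable_prod_root :
  measurable_fun [set: Omega] (fun w => (\prod_(i < n) root_ratio p q (X i w))%R).
Proof.
have mX (i : 'I_n) : measurable_fun [set: Omega] (root_ratio p q \o X i).
  by apply: measurableT_comp => //; exact: measurable_root_ratio hp hq.
rewrite (_ : (fun w => _) = fun w =>
  (\prod_(i <- index_enum 'I_n) (root_ratio p q \o X i) w)%R)//.
by apply: measurable_prod => i _; exact: mX.
Qed.

Lemma measurable_tilted_lr : measurable_fun [set: Omega] tilted_lr.
Proof.
apply: emeasurable_funM; first exact/measurable_EFinP.
exact: measurable_cst.
Qed.

(** For alpha > 0 this is alpha^n / sqrt alpha ^ n; for alpha = 0 the product has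
    expectation 0, and 0 * +oo = 0 = sqrt 0 ^ n. *)
Lemma tilted_lr_integral :
  \int[Pr]_w tilted_lr w = (Num.sqrt alpha ^+ n)%:E.
Proof.
have int_root : \int[P]_x (root_ratio p q x)%:E = alpha%:E.
  by rewrite -(affinityE hp hq).
have alpha0 : (0 <= alpha)%R.
  by rewrite -lee_fin -affE; exact: affinity_ge0.
rewrite /tilted_lr.
under eq_integral do rewrite muleC.
rewrite ge0_integralZl//; last 3 first.
- exact/measurable_EFinP.
- by move=> w _; rewrite lee_fin prodr_ge0// => i _; exact: sqrtr_ge0.
- by rewrite inve_ge0 lee_fin exprn_ge0// sqrtr_ge0.
rewrite (iid_integral_prod (f := fun=> root_ratio p q) hX); last 3 first.
- by move=> i; exact: measurable_root_ratio hp hq.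
- by move=> i x; exact: sqrtr_ge0.
- by move=> i; rewrite int_root.
rewrite int_root /= prodr_const card_ord muleC.
have [->|/negP alphaN0] := eqVneq alpha 0%R.
  by rewrite sqrtr0 !expr0n gtn_eqF//= mul0e.
have sgt0 : (0 < Num.sqrt alpha ^+ n)%R.
  by rewrite exprn_gt0// sqrtr_gt0 lt_neqAle alpha0 andbT eq_sym; apply/negP.
rewrite inver gt_eqF// -EFinM; congr EFin.
rewrite -{1}(sqr_sqrtr alpha0) -exprM mulnC exprM expr2.
by rewrite mulfK// gt_eqF.
Qed.

End tilted_likelihood_ratio.

Section ae_comparison.
Local Open Scope ereal_scope.
Context {dO} {Omega : measurableType dO} {R : realType}.
Variable mu : {measure set Omega -> \bar R}.
Variables (B V : Omega -> \bar R) (l : Omega -> R).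
Hypotheses (mB : measurable_fun [set: Omega] B) (B0 : forall w, 0 <= B w).
Hypotheses (ml : measurable_fun [set: Omega] l).
Hypothesis intV : mu.-integrable [set: Omega] V.
Hypothesis BlV : {ae mu, forall w, B w + (l w)%:E <= V w}.

Let mlE : measurable_fun [set: Omega] (EFin \o l).
Proof. exact/measurable_EFinP. Qed.

Let mV : measurable_fun [set: Omega] V.
Proof. by case/integrableP : intV. Qed.

Let pos_lty : \int[mu]_w (EFin \o l)^\+ w < +oo.
Proof.
apply: le_lt_trans (integral_funepos_lt_pinfty measurableT intV).
apply: ae_ge0_le_integral => //.
- exact: measurable_funepos.
- exact: measurable_funepos.
apply: filterS BlV => w BlVw _; rewrite !funeposE.
rewrite ge_max le_max le_max lexx orbT andbT.
by rewrite (le_trans _ BlVw)// leeDr.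
Qed.

Lemma ae_comparison_lty : \int[mu]_w (l w)%:E < +oo.
Proof.
rewrite integralE; apply: le_lt_trans pos_lty.
by rewrite geeDl// oppe_le0 integral_ge0.
Qed.

(** The function V - l dominates B, hence is almost everywhere nonnegative and has
    the same integral as its positive part. *)
Lemma ae_comparison_le : \int[mu]_w (l w)%:E \is a fin_num ->
  \int[mu]_w B w <= \int[mu]_w V w - \int[mu]_w (l w)%:E.
Proof.
move=> lfin.
have intl : mu.-integrable [set: Omega] (EFin \o l).
  apply/integrableP; split => //.
  by rewrite (integral_fin_num_abs mu measurableT ml).
rewrite -integralB//.
have VlB : {ae mu, forall w, B w <= V w - (l w)%:E}.
  by apply: filterS BlV => w; rewrite leeBrDr.
apply: (@le_trans _ _ (\int[mu]_w (V \- (EFin \o l))^\+ w)).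
  apply: ae_ge0_le_integral => //.
  - by apply: measurable_funepos; exact: emeasurable_funB.
  - by apply: filterS VlB => w h _; rewrite funeposE le_max h.
rewrite le_eqVlt; apply/orP; left; apply/eqP.
apply: ae_eq_integral => //.
- by apply: measurable_funepos; exact: emeasurable_funB.
- exact: emeasurable_funB.
apply: filterS VlB => w h _; rewrite funeposE; apply/max_idPl.
exact: le_trans h.
Qed.

End ae_comparison.

(** The parameter set enters only through a countable index type J: zeta is the
    index selected by the data, and C bounds the finite sums of alpha^(n/2). *)
Section penalized_mle_risk.
Local Open Scope ereal_scope.
Context {R : realType} {dT} {T : measurableType dT}.
Context {dO} {Omega : measurableType dO} (Pr : probability Omega R).
Context {d n : nat} {J : countType}.
Variables (mu : {measure set T -> \bar R}) (P : probability T R) (p : T -> R).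
Variables (Theta_eps : set 'rV[R]_d).
Variables (Pt : 'rV[R]_d -> probability T R) (pt : 'rV[R]_d -> T -> R).
Variables (X : 'I_n -> {RV Pr >-> T}).
Variables (L : 'rV[R]_d -> R) (that : n.-tuple T -> 'rV[R]_d).
Hypothesis hp : is_density mu P p.
Hypothesis hpt :
  forall theta, Theta_eps theta -> is_density mu (Pt theta) (pt theta).
Hypothesis hX : iid P X.
Hypothesis hthat : is_penalized_mle Theta_eps pt L that.
Hypothesis n0 : (0 < n)%N.
Variables (point : J -> 'rV[R]_d) (zeta : Omega -> J) (C : R).
Hypothesis zetaE : forall w, that (sample X w) = point (zeta w).
Hypothesis mzeta : forall i, measurable (zeta @^-1` [set i]).
Hypothesis C_gt0 : (0 < C)%R.

Let alpha i : R := fine (affinity mu p (pt (point i))).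

Hypothesis sumC : forall s : seq J, uniq s ->
  (forall i, i \in s -> Theta_eps (point i)) ->
  (\sum_(i <- s) Num.sqrt (alpha i) ^+ n <= C)%R.

Let Theta_zeta w : Theta_eps (point (zeta w)).
Proof. by rewrite -zetaE; case: hthat. Qed.

Let affE i : Theta_eps (point i) ->
  affinity mu p (pt (point i)) = (alpha i)%:E.
Proof.
move=> Ti; rewrite fineK// ge0_fin_numE; last exact: affinity_ge0.
by apply: le_lt_trans (affinity_le1 hp (hpt Ti)) _; exact: ltry.
Qed.

(* Parameters outside the model have no density, hence the default value. *)
Let G i w : \bar R := if point i \in Theta_eps
  then tilted_lr p (pt (point i)) X (alpha i) w else 0.

Let mG i : measurable_fun [set: Omega] (G i).
Proof.
rewrite /G; have [/set_mem Ti|_] := boolP (point i \in Theta_eps).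
  exact: measurable_tilted_lr hp (hpt Ti) _.
exact: measurable_cst.
Qed.

Let G_ge0 i w : 0 <= G i w.
Proof. by rewrite /G; case: ifP => // _; exact: tilted_lr_ge0. Qed.

Let G_sum_le (s : seq J) : uniq s -> \sum_(i <- s) \int[Pr]_w G i w <= C%:E.
Proof.
move=> us; rewrite (bigID (fun i => point i \in Theta_eps)) /=.
rewrite [X in _ + X]big1 ?adde0; last first.
  move=> i /negPf Ti; rewrite (eq_integral (cst 0)) ?integral0// => w _.
  by rewrite /G Ti.
rewrite -big_filter (eq_big_seq (fun i => (Num.sqrt (alpha i) ^+ n)%:E)); last first.
  move=> i; rewrite mem_filter => /andP[Ti _].
  rewrite -(tilted_lr_integral hp (hpt (set_mem Ti)) hX (affE (set_mem Ti)) n0).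
  by apply: eq_integral => w _; rewrite /G Ti.
rewrite sumEFin lee_fin sumC ?filter_uniq// => i.
by rewrite mem_filter => /andP[/set_mem].
Qed.

Let Y w := G (zeta w) w.

Let mY : measurable_fun [set: Omega] Y.
Proof. exact: measurable_countable_selection. Qed.

Let Y_le : \int[Pr]_w Y w <= C%:E.
Proof. exact: countable_selection_integral_le. Qed.

Let Y_ge0 w : 0 <= Y w. Proof. exact: G_ge0. Qed.

Let Y_integrable : Pr.-integrable [set: Omega] Y.
Proof.
apply/integrableP; split => //.
under eq_integral do rewrite gee0_abs//.
exact: le_lt_trans Y_le (ltry _).
Qed.

Let Bh w := bhattacharyya mu p (pt (that (sample X w))).

Let mBh : measurable_fun [set: Omega] Bh.
Proof.
rewrite (_ : Bh = fun w => bhattacharyya mu p (pt (point (zeta w)))).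
  apply: (measurable_countable_selection mzeta
    (G := fun i _ => bhattacharyya mu p (pt (point i)))) => i.
  exact: measurable_cst.
by apply/funext => w; rewrite /Bh zetaE.
Qed.

Let Bh_ge0 w : 0 <= Bh w.
Proof.
rewrite /Bh zetaE mule_ge0// lne_ge0 (affE (Theta_zeta w)) inver.
have [_|a0] := eqVneq (alpha (zeta w)) 0%R; first exact: leey.
have a1 : (alpha (zeta w) <= 1)%R.
  by rewrite -lee_fin -(affE (Theta_zeta w)); exact: affinity_le1 hp (hpt _).
have age0 : (0 <= alpha (zeta w))%R.
  by rewrite -lee_fin -(affE (Theta_zeta w)); exact: affinity_ge0.
by rewrite lee_fin invf_ge1// lt_neqAle eq_sym a0.
Qed.

Let Lh w := L (that (sample X w)).

Let mLh : measurable_fun [set: Omega] Lh.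
Proof.
rewrite (_ : Lh = fun w => L (point (zeta w))).
  apply: (measurable_countable_selection mzeta (G := fun i _ => L (point i))) => i.
  exact: measurable_cst.
by apply/funext => w; rewrite /Lh zetaE.
Qed.

Section fixed_theta.
Variable theta : 'rV[R]_d.
Hypothesis Theta_theta : Theta_eps theta.
Hypothesis Dfin : rel_entropy mu p (pt theta) < +oo.

Let D : R := fine (rel_entropy mu p (pt theta)).

Let DE : rel_entropy mu p (pt theta) = D%:E.
Proof.
rewrite fineK// -(loglr_integral hp (hpt Theta_theta)).
exact/integrable_fin_num/(loglr_integrable hp (hpt Theta_theta)).
Qed.

Let llr w := \sum_(i < n) loglr p (pt theta) (X i w).

Let int_loglr i := loglr_sample_integrable hp (hpt Theta_theta) hX i Dfin.

Let llr_integrable : Pr.-integrable [set: Omega] llr.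
Proof.
rewrite (_ : llr = fun w => \sum_(i <- index_enum 'I_n) loglr p (pt theta) (X i w))//.
by apply: integrable_sum => // i _; exact: int_loglr.
Qed.

Let llr_integral : \int[Pr]_w llr w = (n%:R * D)%:E.
Proof.
rewrite integral_sum//.
under eq_bigr do rewrite (loglr_sample_integral hp (hpt Theta_theta) hX) DE.
by rewrite sumEFin sumr_const card_ord mulr_natl.
Qed.

Let k : R := (2 * ln C - 2 + L theta)%R.

Let V w := (2 / C)%:E * Y w + (k%:E + llr w).

Let V_integrable : Pr.-integrable [set: Omega] V.
Proof.
apply: integrableD => //; first exact: integrableZl.
by apply: integrableD => //; exact: finite_measure_integrable_cst.
Qed.

Let V_integral_le :
  \int[Pr]_w V w <= (2 * ln C + L theta + n%:R * D)%:E.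
Proof.
have intk : Pr.-integrable [set: Omega] (cst k%:E).
  exact: finite_measure_integrable_cst.
rewrite integralD//; [|exact: integrableZl|exact: integrableD].
rewrite integralD// integralZl// integral_cst// llr_integral.
rewrite [X in (k%:E * X)](_ : _ = 1); last exact: probability_setT.
rewrite mule1.
apply: (@le_trans _ _ ((2 / C)%:E * C%:E + (k%:E + (n%:R * D)%:E))).
  by rewrite leeD2r// lee_pmul2l// lte_fin divr_gt0.
by rewrite -EFinM -!EFinD lee_fin divfK ?gt_eqF// /k; lra.
Qed.

(** Where Y and the log-likelihood ratios are finite, all densities involved and
    the affinity of the selected parameter are positive. *)
Let ae_bound :
  {ae Pr, forall w, (n%:R / 2)%:E * Bh w + (Lh w)%:E <= V w}.
Proof.
have aeY := integrable_ae measurableT Y_integrable.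
have ael : {ae Pr, forall w, forall i, [set: Omega] w ->
    loglr p (pt theta) (X i w) \is a fin_num}.
  by apply: filter_forall => i; exact: (integrable_ae measurableT (int_loglr i)).
apply: filterS2 aeY ael => w /(_ I) Yfin lfin.
pose x := sample X w.
have xE i : tnth x i = X i w by rewrite tnth_mktuple.
have Tx : Theta_eps (that x) by rewrite zetaE.
have lP i := loglr_fin_num hp (hpt Theta_theta) (lfin i I).
have p_gt0 i : (0 < p (tnth x i))%R by rewrite xE; case: (lP i).
have pt_gt0 i : (0 < pt theta (tnth x i))%R by rewrite xE; case: (lP i).
pose a := alpha (zeta w).
have a_ge0 : (0 <= a)%R.
  by rewrite -lee_fin -(affE (Theta_zeta w)); exact: affinity_ge0.
pose Z : R := (\prod_(i < n) root_ratio p (pt (that x)) (tnth x i))%R.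
have Z_gt0 : (0 < Z)%R.
  by apply: prodr_gt0 => i _; apply: (root_ratio_gt0 hthat Theta_theta).
have YE : Y w = Z%:E * (Num.sqrt a ^+ n)%:E^-1.
  rewrite /Y /G mem_set// /tilted_lr; congr (_%:E * _).
  by apply: eq_bigr => i _; rewrite xE -zetaE.
have a_gt0 : (0 < a)%R.
  rewrite lt_neqAle a_ge0 andbT; apply/eqP => a0.
  move: Yfin; rewrite YE -a0 sqrtr0 expr0n gtn_eqF//= inve0.
  by rewrite gt0_muley// lte_fin.
have sa_gt0 : (0 < Num.sqrt a ^+ n)%R by rewrite exprn_gt0// sqrtr_gt0.
have BhE : (n%:R / 2)%:E * Bh w = (- (n%:R * ln a))%:E.
  rewrite /Bh zetaE /bhattacharyya (affE (Theta_zeta w)) -/a.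
  rewrite inver gt_eqF// lne_EFin ?invr_gt0// lnV// -!EFinM; congr EFin.
  by field.
have llrE : llr w = (\sum_(i < n)
    (ln (p (tnth x i)) - ln (pt theta (tnth x i))))%:E.
  rewrite -sumEFin; apply: eq_bigr => i _; rewrite xE.
  by case: (lP i).
rewrite BhE /V YE llrE inver gt_eqF// -!EFinM -!EFinD lee_fin.
exact: (pointwise_bound hthat Theta_theta pt_gt0 p_gt0 a_gt0 C_gt0).
Qed.

Let mnBh : measurable_fun [set: Omega] (fun w => (n%:R / 2)%:E * Bh w).
Proof. exact: measurable_funeM. Qed.

Let nBh_ge0 w : 0 <= (n%:R / 2)%:E * Bh w.
Proof. by rewrite mule_ge0// lee_fin divr_ge0. Qed.

Lemma mle_penalty_lty : 'E_Pr[Lh] < +oo.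
Proof.
by rewrite unlock; exact: (ae_comparison_lty nBh_ge0 mLh V_integrable ae_bound).
Qed.

Lemma mle_risk_le (e : R) : 'E_Pr[Lh] = e%:E ->
  2^-1%:E * \int[Pr]_w Bh w <=
  rel_entropy mu p (pt theta) + (L theta / n%:R)%:E + ((2 * ln C - e) / n%:R)%:E.
Proof.
rewrite unlock => eE.
have efin : \int[Pr]_w (Lh w)%:E \is a fin_num by rewrite eE.
have := ae_comparison_le mnBh nBh_ge0 mLh V_integrable ae_bound efin.
rewrite eE ge0_integralZl// ?lee_fin ?divr_ge0//.
move=> /le_trans /(_ (leeB V_integral_le (lexx _))).
have nr0 : (0 < n%:R :> R)%R by rewrite ltr0n.
rewrite DE -EFinB -!EFinD.
have /ge0_fin_numE : 0 <= \int[Pr]_w Bh w by exact: integral_ge0.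
case: (\int[Pr]_w Bh w) => [b| |] _.
- rewrite -!EFinM !lee_fin => h.
  rewrite -(ler_pM2l nr0); apply: le_trans (_ : _ <= n%:R / 2 * b)%R _.
    by rewrite mulrA.
  apply: (le_trans h); rewrite le_eqVlt; apply/orP; left; apply/eqP.
  by field; rewrite gt_eqF.
- by rewrite gt0_muley ?lte_fin ?divr_gt0// leye_eq.
- by move=> _; rewrite gt0_muleNy ?lte_fin ?invr_gt0// leNye.
Qed.

End fixed_theta.

(** Extended-real bookkeeping: when E L is finite the bounds for each theta pass
    to the infimum, when E L = -oo the right-hand side is +oo, and E L = +oo
    forces infinite relative entropies. *)
Lemma mle_risk_resolvability :
  (resolvability mu p Theta_eps pt L n +? - 'E_Pr[Lh]) ->
  \int[Pr]_w Bh w <= 2%:E * (resolvability mu p Theta_eps pt L n +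
    ((2 * ln C)%:E - 'E_Pr[Lh]) / (n%:R)%:E).
Proof.
set rho := resolvability _ _ _ _ _ _.
have nr0 : (0 < n%:R :> R)%R by rewrite ltr0n.
rewrite inver gt_eqF//.
have rho_lty : rho != +oo -> exists2 theta, Theta_eps theta &
    rel_entropy mu p (pt theta) < +oo.
  move=> rhoNy; apply: contrapT => noth.
  move: rhoNy; apply/negP; rewrite negbK; apply/eqP/ereal_inf_pinfty.
  move=> _ [theta Tt <-]; have [Dfin|] := ltP (rel_entropy mu p (pt theta)) +oo.
    by exfalso; apply: noth; exists theta.
  by rewrite leye_eq => /eqP ->.
case EE : ('E_Pr[Lh]) => [e| |] hdef.
- have le_rho : 2^-1%:E * \int[Pr]_w Bh w - ((2 * ln C - e) / n%:R)%:E <= rho.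
    apply: le_ereal_inf_tmp => _ [theta Tt <-].
    have [Dfin|] := ltP (rel_entropy mu p (pt theta)) +oo.
      by rewrite leeBlDr//; exact: mle_risk_le.
    by rewrite leye_eq => /eqP ->; rewrite leey.
  move: le_rho; rewrite leeBlDr// => le_rho.
  rewrite -EFinB -EFinM.
  rewrite -(@lee_pmul2l _ 2^-1%:E)// ?lte_fin ?invr_gt0//.
  by rewrite muleA -EFinM mulVf// mul1e.
- have [rhoy|/rho_lty[theta Tt Dfin]] := eqVneq rho +oo.
    by move: hdef; rewrite rhoy.
  by have := mle_penalty_lty Tt Dfin; rewrite EE.
- have -> : (2 * ln C)%:E - -oo = +oo :> \bar R by [].
  rewrite gt0_mulye ?lte_fin ?invr_gt0//.
  have rhoNNy : rho != -oo by apply: contraTneq hdef => ->.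
  by rewrite addey// gt0_muley ?lte_fin// leey.
Qed.

End penalized_mle_risk.

(** * The risk bound *)

Theorem mainTheorem2
  (R : realType)
  (dT : measure_display) (T : measurableType dT)
  (mu : {measure set T -> \bar R})
  (dO : measure_display) (Omega : measurableType dO)
  (Pr : probability Omega R)
  (P : probability T R) (p : T -> R)
  (d n : nat)
  (Theta Theta_eps : set 'rV[R]_d) (eps : R)
  (Pt : 'rV[R]_d -> probability T R) (pt : 'rV[R]_d -> T -> R)
  (X : 'I_n -> {RV Pr >-> T})
  (L : 'rV[R]_d -> R) (that : n.-tuple T -> 'rV[R]_d)
  (ts tts : 'rV[R]_d) (r a b c : R)
  (hp : is_density mu P p)
  (hpt : forall theta, Theta theta -> is_density mu (Pt theta) (pt theta))
  (heps : 0 < eps)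
  (hdisc : is_discretization eps Theta Theta_eps)
  (hX : iid P X)
  (hthat : is_penalized_mle Theta_eps pt L that)
  (hts : Theta ts) (htts : Theta tts)
  (ha : 0 < a) (hb : 0 < b) (hc : 0 < c)
  (hout : forall theta, Theta theta -> ~ eball ts r theta ->
     (affinity mu p (pt theta) <= (a / enorm (theta - ts) `^ b)%:E)%E)
  (hin : forall theta, Theta theta -> eball ts r theta ->
     (affinity mu p (pt theta)
        <= (expR (- (c * enorm (theta - tts) ^+ 2)))%:E)%E)
  (hr : Num.max (11 * a `^ b^-1) (3 * eps) <= r)
  (hn : 2 * (d%:R + 1) / b <= n%:R)
  (* the right-hand side is not of the form oo - oo *)
  (hdef : (resolvability mu p Theta_eps pt L n
             +? - 'E_Pr[fun w => L (that (sample X w))])%E) :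
  (\int[Pr]_w bhattacharyya mu p (pt (that (sample X w)))
   <= 2%:E * (resolvability mu p Theta_eps pt L n
      + ((d%:R * (2 * ln (1 + 2 * Num.sqrt (2 * pi)
                                / (eps * Num.sqrt (n%:R * c)))
                + 2 * ln (1 + 4 * Num.sqrt 2 * r
                                / (eps * Num.sqrt (n%:R * b)))) + 3)%:E
         - 'E_Pr[fun w => L (that (sample X w))]) / (n%:R)%:E))%E.
Proof.
case: hdisc => v TE.
have sub_Theta theta : Theta_eps theta -> Theta theta by rewrite TE => -[].
have nr0 : 0 < n%:R :> R.
  by apply: lt_le_trans hn; rewrite divr_gt0// mulr_gt0// ltr_wpDl.
have n0 : (0 < n)%N by move: nr0; rewrite ltr0n.
have har : 11 * a `^ b^-1 <= r by move: hr; rewrite ge_max => /andP[].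
have r0 : 0 < r by apply: lt_le_trans har; rewrite mulr_gt0// powR_gt0.
have point_inj : injective (lattice_point v eps).
  move=> z1 z2 /addrI /(scalerI (lt0r_neq0 heps)) /rowP z12.
  by apply/rowP => j; have := z12 j; rewrite !mxE => /intr_inj.
have /choice[zeta zetaE] w :
    exists z, that (sample X w) = lattice_point v eps z.
  case: hthat => /(_ (sample X w)) + _ _.
  by rewrite TE => -[_ [z ->]]; exists z.
have msample : measurable_fun [set: Omega] (sample X).
  apply/measurable_fun_tnthP => i.
  rewrite (_ : _ \o _ = X i)//.
  by apply/funext => w /=; rewrite tnth_mktuple.
have mzeta z : measurable (zeta @^-1` [set z]).
  rewrite (_ : _ @^-1` _ =
    sample X @^-1` (that @^-1` [set lattice_point v eps z])).
    rewrite -[_ @^-1` _]setTI; apply: msample => //.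
    by case: hthat.
  by apply/seteqP; split => w /=; rewrite zetaE; [move=> ->|move/point_inj].
set G := 1 + 2 * Num.sqrt (2 * pi) / (eps * Num.sqrt (n%:R * c)).
set H := 1 + 4 * Num.sqrt 2 * r / (eps * Num.sqrt (n%:R * b)).
have G0 : 0 < G.
  by rewrite ltr_wpDr// divr_ge0 ?mulr_ge0 ?sqrtr_ge0 ?ltW.
have H0 : 0 < H.
  by rewrite ltr_wpDr// divr_ge0 ?mulr_ge0 ?sqrtr_ge0 ?ltW.
pose C := expR (3 / 2) * G ^+ d * H ^+ d.
have C0 : 0 < C by rewrite !mulr_gt0 ?expR_gt0 ?exprn_gt0.
have lnC : 2 * ln C = d%:R * (2 * ln G + 2 * ln H) + 3.
  rewrite /C !lnM ?posrE ?mulr_gt0 ?expR_gt0 ?exprn_gt0// expRK !lnXn//.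
  by rewrite -[ln G *+ d]mulr_natl -[ln H *+ d]mulr_natl; field.
have density_eps theta : Theta_eps theta ->
    is_density mu (Pt theta) (pt theta).
  by move=> /sub_Theta; exact: hpt.
rewrite -lnC.
apply: (mle_risk_resolvability hp density_eps hX hthat n0 zetaE mzeta C0 _ hdef).
move=> s us sT.
have aff_fin z : z \in s ->
    affinity mu p (pt (lattice_point v eps z)) \is a fin_num.
  move=> /sT zT; rewrite ge0_fin_numE; last exact: affinity_ge0.
  exact: le_lt_trans (affinity_le1 hp (density_eps _ zT)) (ltry _).
apply: (affinity_sum_le (ts := ts) (tts := tts) heps ha hb hc har hn us).
- by move=> z zs; rewrite fine_ge0//; exact: affinity_ge0.
- move=> z zs far; rewrite -lee_fin fineK ?aff_fin//.
  apply: hout; first exact/sub_Theta/sT.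
  by rewrite /eball /= => /(lt_le_trans far); rewrite ltxx.
- move=> z zs near; rewrite -lee_fin fineK ?aff_fin//.
  by apply: hin => //; exact/sub_Theta/sT.
Qed.
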